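(* Let $\mathbb{K}$ be $\mathbb{R}$ or $\mathbb{C}$, let $n\geq 1$, and let $A\subset\mathbb{K}^n$ be a non-flat compact set. Let $\mathfrak{E}_1$ and $\mathfrak{E}_2$ be two minimal circumscribed ellipsoids (MiCE) of $A$, i.e. ellipsoids in $\mathbb{K}^n$ containing $A$ and having minimal volume among all ellipsoids in $\mathbb{K}^n$ containing $A$. Then $\mathfrak{E}_1=\mathfrak{E}_2$.
   Context: An ellipsoid in $\mathbb{K}^n$ is any translate (by a vector of $\mathbb{K}^n$) of a set $\{\mathbf{x}\in\mathbb{K}^n : \mathbf{x}^{T}M\overline{\mathbf{x}}\leq 1\}$, where $M$ is an $n\times n$ positive definite Hermitian matrix over $\mathbb{K}$ (symmetric if $\mathbb{K}=\mathbb{R}$); equivalently, it is the image of the closed unit ball of $\mathbb{K}^n$ under an invertible $\mathbb{K}$-affine map. For $\mathbb{K}=\mathbb{C}$ these are called complex ellipsoids. Volume is Lebesgue measure on $\mathbb{R}^n$, respectively on $\mathbb{C}^n=\mathbb{R}^{2n}$. A compact set is non-flat if it is not contained in a real affine hyperplane (of $\mathbb{R}^n$, respectively of $\mathbb{R}^{2n}=\mathbb{C}^n$), i.e. if its (real) convex hull has nonempty interior. *)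

(* Defs.v *)
From HB Require Import structures.
From mathcomp Require Import all_boot all_order all_algebra.
From mathcomp Require Import all_classical all_reals all_analysis.
From mathcomp Require Import complex.

Set Implicit Arguments.
Unset Strict Implicit.
Unset Printing Implicit Defensive.

Import Order.TTheory GRing.Theory Num.Theory.
Import numFieldNormedType.Exports.

Local Open Scope classical_set_scope.
Local Open Scope ring_scope.

Section cons_measure.
Context {R : realType} (n : nat).
Notation T := (measurableTypeR R).

Definition cons_pair (p : T * n.-tuple T) : n.+1.-tuple T :=
  [tuple of p.1 :: p.2].

Lemma measurable_cons_pair : measurable_fun [set: T * n.-tuple T] cons_pair.
Proof. by apply: (measurable_cons (f := fst) (g := snd)). Qed.

Variable mu : {sigma_finite_measure set (n.-tuple T) -> \bar R}.

Definition cons_measure : set (n.+1.-tuple T) -> \bar R :=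
  pushforward (lebesgue_measure \x mu)%E cons_pair.

Let cons_measure0 : cons_measure set0 = 0%E.
Proof. by rewrite /cons_measure /pushforward preimage_set0 measure0. Qed.

Let cons_measure_ge0 A : (0 <= cons_measure A)%E.
Proof. by rewrite /cons_measure /pushforward; exact: measure_ge0. Qed.

Let cons_measure_sigma_additive : semi_sigma_additive cons_measure.
Proof.
move=> F mF tF mUF; rewrite /cons_measure /pushforward preimage_bigcup.
have mpre A : measurable A -> measurable (cons_pair @^-1` A).
  by move=> mA; rewrite -[X in measurable X]setTI; exact: measurable_cons_pair.
apply: measure_semi_sigma_additive.
- by move=> k; exact: mpre.
- apply/trivIsetP => /= i j _ _ ij; rewrite -preimage_setI.
  by move/trivIsetP : tF => /(_ _ _ _ _ ij) ->//; rewrite preimage_set0.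
- by rewrite -preimage_bigcup; exact: mpre.
Qed.

HB.instance Definition _ := isMeasure.Build _ _ _ cons_measure
  cons_measure0 cons_measure_ge0 cons_measure_sigma_additive.

Lemma cons_pair_preimage_setX (A : set T) (B : set (n.-tuple T)) :
  cons_pair @^-1` [set t | A (thead t) /\ B [tuple of behead t]] = A `*` B.
Proof.
apply/seteqP; split=> -[x t] /=; rewrite theadE.
  by move=> -[Ax]; rewrite (_ : [tuple of _] = t)//; exact: val_inj.
by move=> -[Ax Bt]; split=> //; rewrite (_ : [tuple of _] = t)//; exact: val_inj.
Qed.

Lemma measurable_cons_setX (A : set T) (B : set (n.-tuple T)) :
  measurable A -> measurable B ->
  measurable [set t : n.+1.-tuple T | A (thead t) /\ B [tuple of behead t]].
Proof.
move=> mA mB; apply: measurableI.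
  rewrite -[X in measurable X]setTI.
  exact: (measurable_tnth (T := T) (@ord0 n)).
by rewrite -[X in measurable X]setTI; exact: (measurable_behead (T := T)).
Qed.

Lemma cons_measureX (A : set T) (B : set (n.-tuple T)) :
  measurable A -> measurable B ->
  cons_measure [set t | A (thead t) /\ B [tuple of behead t]] =
  (lebesgue_measure A * mu B)%E.
Proof.
move=> mA mB.
by rewrite /cons_measure /pushforward cons_pair_preimage_setX product_measure1E.
Qed.

Let cons_measure_sigma_finite : sigma_finite setT cons_measure.
Proof.
have /sigma_finiteP[F [TF ndF Foo]] := sigma_finiteT (@lebesgue_measure R).
have /sigma_finiteP[G [TG ndG Goo]] := sigma_finiteT mu.
exists (fun k => [set t | F k (thead t) /\ G k [tuple of behead t]]).
  apply/esym/seteqP; split=> // t _.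
  have [i _ Fi] : (\bigcup_k F k) (thead t) by rewrite -TF.
  have [j _ Gj] : (\bigcup_k G k) [tuple of behead t] by rewrite -TG.
  exists (maxn i j) => //=; split.
    by move: Fi; apply/subsetPset/ndF; rewrite leq_maxl.
  by move: Gj; apply/subsetPset/ndG; rewrite leq_maxr.
move=> k; have [mF Foo'] := Foo k; have [mG Goo'] := Goo k.
split; first exact: measurable_cons_setX.
by rewrite [ltLHS]cons_measureX// lte_mul_pinfty// ge0_fin_numE.
Qed.

HB.instance Definition _ := Measure_isSigmaFinite.Build _ _ _ cons_measure
  cons_measure_sigma_finite.

End cons_measure.

Section lebesgue_tuple.
Context {R : realType}.
Notation T := (measurableTypeR R).

(* Lebesgue measure on R^n, as the n-fold product of [lebesgue_measure] carried
   over to tuples; [lebesgue_tuple_box] gives its value on boxes. *)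
Fixpoint lebesgue_tuple n : {sigma_finite_measure set (n.-tuple T) -> \bar R} :=
  match n with
  | 0%N => \d_([tuple] : 0.-tuple T)
  | n'.+1 => cons_measure (lebesgue_tuple n')
  end.

Let tnth_behead_lift n (t : n.+1.-tuple T) (i : 'I_n) :
  tnth [tuple of behead t] i = tnth t (lift ord0 i).
Proof. by rewrite [t in RHS]tuple_eta tnthS. Qed.

Lemma lebesgue_tuple_box n (a b : 'I_n -> R) : (forall i, a i <= b i) ->
  lebesgue_tuple n [set t | forall i, a i <= tnth t i <= b i] =
  (\prod_(i < n) (b i - a i))%:E.
Proof.
elim: n a b => [|n IH] a b ab /=.
  by rewrite big_ord0 /dirac indicE mem_set// => -[].
have -> : [set t : n.+1.-tuple T | forall i, a i <= tnth t i <= b i] =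
    [set t | `[a ord0, b ord0]%classic (thead t) /\
      [set u : n.-tuple T | forall i, a (lift ord0 i) <= tnth u i
                                      <= b (lift ord0 i)] [tuple of behead t]].
  apply/seteqP; split=> t /=.
    move=> abt; split; first by rewrite in_itv/=; exact: abt.
    by move=> i; rewrite tnth_behead_lift; exact: abt.
  move=> []; rewrite in_itv/= => t0 tS i.
  by case: (unliftP ord0 i) => [j|] -> //; rewrite -tnth_behead_lift; exact: tS.
rewrite cons_measureX//; last first.
  rewrite (_ : [set u | _] = \bigcap_(i in [set: 'I_n])
    (tnth (T := T)^~ i @^-1` `[a (lift ord0 i), b (lift ord0 i)])); last first.
    apply/seteqP; split=> u /= H i; first by move=> _; rewrite /= in_itv/=; exact: H.
    by have := H i I; rewrite /= in_itv.
  apply: fin_bigcap_measurable => // i _.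
  rewrite -[X in measurable X]setTI; apply: (measurable_tnth (T := T)) => //.
rewrite IH; last by move=> i; exact: ab.
rewrite lebesgue_measure_itv/= lte_fin big_ord_recl EFinM.
by case: ltgtP (ab ord0) => // -> _; rewrite subrr.
Qed.

End lebesgue_tuple.

Section volume_flatness.
Context {R : realType} (m : nat).

Definition volume (E : set 'cV[R]_m) : \bar R :=
  lebesgue_tuple m [set t | E (\col_i tnth t i)].

Definition non_flat (A : set 'cV[R]_m) : Prop :=
  forall (a : 'cV[R]_m) (b : R), a != 0 ->
    ~ A `<=` [set x | (a^T *m x) 0 0 = b].

End volume_flatness.

(* [theta] is the conjugation of K: [idfun] for the reals, [Num.conj] for the
   complex numbers. *)
Section ellipsoids.
Context {K : numFieldType} (theta : K -> K) (n : nat).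
Implicit Types (M : 'M[K]_n) (E : set 'cV[K]_n).

Definition quadform M (x : 'cV[K]_n) : K :=
  (x^T *m M *m map_mx theta x) 0 0.

(* In a numFieldType such as R[i], [0 < z] and [z <= 1] entail that z is real. *)
Definition posdefmx M : Prop :=
  M \is hermitianmx n false theta /\ forall x, x != 0 -> 0 < quadform M x.

Definition ellipsoid E : Prop :=
  exists (M : 'M[K]_n) (c : 'cV[K]_n),
    posdefmx M /\ E = [set c + x | x in [set x | quadform M x <= 1]].

(* [vol] is a parameter because Lebesgue measure on K^n depends on the real
   structure of K, which a numFieldType does not record. *)
Definition is_MiCE {R : realType} (vol : set 'cV[K]_n -> \bar R)
    (A E : set 'cV[K]_n) : Prop :=
  [/\ ellipsoid E, A `<=` E &
      forall E', ellipsoid E' -> A `<=` E' -> (vol E <= vol E')%E].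

End ellipsoids.

(* The identification C^n = R^(2n): real parts first, then imaginary parts. *)
Definition realify {R : realType} n (z : 'cV[R[i]]_n) : 'cV[R]_(n + n) :=
  col_mx (map_mx (@complex.Re R) z) (map_mx (@complex.Im R) z).

Definition MiCE_real {R : realType} n (A E : set 'cV[R]_n) : Prop :=
  is_MiCE idfun (@volume R n) A E.

Definition MiCE_complex {R : realType} n (A E : set 'cV[R[i]]_n) : Prop :=
  is_MiCE Num.conj (fun F => volume (@realify R n @` F)) A E.

(* Main.v *)
Require Import Defs.
From HB Require Import structures.
From mathcomp Require Import all_boot all_order all_algebra.
From mathcomp Require Import all_classical all_reals all_analysis.
From mathcomp Require Import measurable_realfun complex.
From mathcomp Require Import ring lra.

(** The uniqueness of the minimal circumscribed ellipsoid comes from averaging.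
    Let E1 and E2 be two minimal ellipsoids, given by f_i(x) = q_i(x - c_i) <= 1
    with q_i a positive definite Hermitian form.  Completing the square
    ([average_quadform]) gives (f_1 + f_2) / 2 = q(x - c) + s with
    q = (q_1 + q_2) / 2 and s = (f_1(c) + f_2(c)) / 2, so s >= 0, and s = 0 only
    if c = c_1 = c_2.  The set where (f_1 + f_2) / 2 <= 1 contains A and is again
    an ellipsoid (non-flatness of A excludes s >= 1); it is the competitor to
    which minimality is applied.

    If q_1 = q_2, the competitor is a homothetic copy of E1 with ratio
    sqrt (1 - s), hence s = 0 and E1 = E2.  If q_1 and q_2 differ, the competitor
    is strictly smaller, because {q <= 1} has a smaller volume than {q_1 <= 1}
    and {q_2 <= 1}, whose volumes are equal ([volume_midpoint_lt]).  This last
    fact is usually read off the strict log-concavity of the determinant.  Here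
    it is obtained without any formula for the volume of an ellipsoid: for the
    tent function phi(u) = max (0, 1 - u), Fubini on the hypograph of phi o q, together with
    the scaling law vol {q <= r} = sqrt r ^ m * vol {q <= 1}, gives
    int phi(q) = k * vol {q <= 1} with a constant k that depends on the dimension
    only ([integral_tent]).  Since phi is convex, int phi is midpoint convex in q,
    and the inequality is strict since phi is strictly convex across u = 1 and
    some cube lies in {q_1 < 1 < q_2} after exchanging q_1 and q_2 if necessary
    ([separating_cube]).

    The real and the complex cases are one argument ([MiCE_unique]): a Hermitian
    form on C^n is a real quadratic form on R^(2n) ([realify_quadform]), so every
    volume is computed in a real space, while the averaging is done over the base
    field and thus keeps the competitor among the ellipsoids of that field. *)

Set Implicit Arguments.
Unset Strict Implicit.
Unset Printing Implicit Defensive.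

Import Order.TTheory GRing.Theory Num.Theory.
Import numFieldNormedType.Exports.

Local Open Scope classical_set_scope.
Local Open Scope ring_scope.

(** * Lebesgue measure under translations and homotheties *)

Section homothety.
Context {R : realType}.
Local Notation T := (measurableTypeR R).

Lemma lebesgue_measure_affine (r c : R) (A : set T) : 0 < r -> measurable A ->
  lebesgue_measure A =
  (r%:E * lebesgue_measure ((fun x : R => (r * x + c)%R) @^-1` A))%E.
Proof.
move=> r0 mA.
pose f : T -> T := fun x : R => r * x + c.
have mf : measurable_fun setT f.
  by apply: measurable_funD => //; apply: measurable_funM.
pose mu : {measure set T -> \bar R} :=
  mscale (NngNum (ltW r0)) (pushforward lebesgue_measure f).
rewrite (@lebesgue_measure_unique _ (mu mf)) // => _ [[a b] _ <-].
rewrite /mu /= /mscale /= /pushforward.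
have -> : f @^-1` `]a, b] = `](a - c) / r, (b - c) / r]%classic.
  apply/seteqP; split=> x /=; rewrite !in_itv /= /f ltr_pdivrMr // ler_pdivlMr //;
   lra.
rewrite !lebesgue_measure_itv /= !lte_fin ltr_pM2r ?invr_gt0 // ltrD2r.
case: ifP => _; last by rewrite mule0.
by rewrite -!EFinB -EFinM; congr (_%:E); field; rewrite gt_eqF.
Qed.

Definition affine_tuple m (r : R) (c : 'I_m -> R) (t : m.-tuple T) : m.-tuple T :=
  [tuple (r * (tnth t i : R) + c i : R) | i < m].

Lemma measurable_affine_tuple m r (c : 'I_m -> R) :
  measurable_fun setT (affine_tuple r c).
Proof.
apply/measurable_fun_tnthP => i.
rewrite (_ : _ \o _ = fun t => r * (tnth t i : R) + c i); last first.
  by apply/funext => t /=; rewrite tnth_mktuple.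
apply: measurable_funD => //; apply: measurable_funM => //.
exact: measurable_tnth.
Qed.

(** By induction on the dimension: both sides are measures that take the same
    value on products of a measurable set of reals by a measurable set of tuples,
    and such values determine the product measure. *)
Lemma lebesgue_tuple_affine m (r : R) (c : 'I_m -> R) (A : set (m.-tuple T)) :
  0 < r -> measurable A ->
  lebesgue_tuple m A =
  ((r ^+ m)%:E * lebesgue_tuple m (affine_tuple r c @^-1` A))%E.
Proof.
move=> r0; elim: m c A => [|m IH] c A mA.
  rewrite expr0 mul1e /= /dirac !indicE; congr (_%:E).
  congr (nat_of_bool _)%:R; congr (_ \in _); apply/seteqP.
  by split=> t /=; rewrite (tuple0 t) (tuple0 (affine_tuple _ _ _)).
pose f : T -> T := fun x : R => r * x + c ord0.
have mf : measurable_fun setT f.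
  by apply: measurable_funD => //; apply: measurable_funM.
pose g := affine_tuple r (c \o lift ord0).
have mg : measurable_fun setT g by exact: measurable_affine_tuple.
pose h (p : T * m.-tuple T) := (f p.1, g p.2).
have mh : measurable_fun setT h.
  apply/measurable_fun_pairP; split.
    exact: (measurableT_comp mf).
  exact: (measurableT_comp mg).
have r0' : 0 <= r ^+ m.+1 by rewrite exprn_ge0 // ltW.
pose mu : {measure set (T * m.-tuple T) -> \bar R} :=
  mscale (NngNum r0') (pushforward (lebesgue_measure \x lebesgue_tuple m)%E h).
rewrite /= /cons_measure /pushforward.
rewrite (@product_measure_unique _ _ _ _ _ _ _ (mu mh)).
- rewrite /mu /= /mscale /= /pushforward; congr (_ * _)%E; congr (_ _).
  apply/seteqP; split=> -[x t] /=; rewrite /h /= (_ : affine_tuple _ _ _ =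
    cons_pair (f x, g t)) //; apply: eq_from_tnth => i; rewrite tnth_mktuple;
  case: (unliftP ord0 i) => [j|] ->; rewrite ?tnthS ?tnth0 //=;
  by rewrite tnth_mktuple.
- move=> B C mB mC; rewrite /mu /= /mscale /= /pushforward.
  rewrite (_ : h @^-1` _ = (f @^-1` B) `*` (g @^-1` C)); last first.
    by apply/seteqP; split=> -[].
  rewrite product_measure1E; last 2 first.
  + by rewrite -[X in measurable X]setTI; apply: mf.
  + by rewrite -[X in measurable X]setTI; apply: mg.
  rewrite (lebesgue_measure_affine (c ord0) r0 mB) (IH (c \o lift ord0) _ mC).
  by rewrite exprS EFinM muleACA.
- rewrite -[X in measurable X]setTI; exact: measurable_cons_pair.
Qed.

End homothety.

(** * Volume of sublevel sets as an integral *)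

Section layer_cake.
Context {R : realType}.
Local Notation T := (measurableTypeR R).

Definition sublevel {U : Type} (Q : U -> R) (r : R) : set U := [set x | Q x <= r].

Definition tent (u : R) : R := Num.max 0 (1 - u).

(** Layer-cake formula: slicing the hypograph of [tent \o Q] at height [s] gives
    the sublevel set of [Q] at [1 - s], whose volume is a fixed multiple of that
    of the unit sublevel set.  Hence [c] is the integral of [sqrt (1 - s) ^ m] over
    [0 <= s < 1], the same for all [Q], and comparing volumes amounts to comparing
    integrals of tents. *)
Lemma integral_tent m : exists c : \bar R, [/\ (0 <= c)%E, (c <= 1)%E &
  forall Q : m.-tuple T -> R, measurable_fun setT Q -> (forall t, 0 <= Q t) ->
    (forall r, 0 < r -> lebesgue_tuple m (sublevel Q r) =
       ((Num.sqrt r ^+ m)%:E * lebesgue_tuple m (sublevel Q 1))%E) ->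
    (\int[lebesgue_tuple m]_t (tent (Q t))%:E =
       c * lebesgue_tuple m (sublevel Q 1))%E].
Proof.
pose w (s : T) : R := Num.sqrt (1 - s) ^+ m.
have mw : measurable_fun setT w.
  apply: measurable_funX.
  apply: (measurableT_comp (f := @Num.sqrt R)).
    exact: (continuous_measurable_fun (@sqrt_continuous R)).
  exact: measurable_funB.
pose I : set T := [set` `[0 : R, 1[].
have mI : measurable I by exact: measurable_itv.
have lI : lebesgue_measure I = 1%E.
  by rewrite /I lebesgue_measure_itv /= lte_fin ltr01 oppr0 adde0.
have mwE : measurable_fun I (EFin \o w).
  by apply/measurable_EFinP; exact: measurable_funTS.
have w0 s : 0 <= w s by rewrite exprn_ge0 // sqrtr_ge0.
exists (\int[lebesgue_measure]_(s in I) (w s)%:E)%E; split.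
- by apply: integral_ge0 => s _; rewrite lee_fin.
- apply: (@le_trans _ _ (\int[lebesgue_measure]_(s in I) (cst 1 s)))%E.
    apply: ge0_le_integral => //.
      by move=> s _; rewrite lee_fin.
    move=> s /=; rewrite /I /= in_itv /= => /andP[s0 s1].
    rewrite lee_fin exprn_ile1 ?sqrtr_ge0 //.
    by rewrite -[leRHS]sqrtr1 ler_wsqrtr // lerBlDr lerDl.
  by rewrite integral_cst // mul1e [leLHS]lI.
move=> Q mQ Q0 hQ.
(* The height [s = 1] is left out: it would call for scaling by the factor 0. *)
pose H : set (T * m.-tuple T) := [set p | 0 <= p.1 < 1 /\ Q p.2 <= 1 - p.1].
have mH : measurable H.
  pose f1 (p : T * m.-tuple T) : R := p.1.
  have mf1 : measurable_fun setT f1 by exact: measurable_fst.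
  have mf2 : measurable_fun setT (fun p : T * m.-tuple T => Q p.2).
    exact: (measurableT_comp mQ).
  rewrite (_ : H = (f1 @^-1` I) `&`
    ((fun p => f1 p + Q p.2) @^-1` `]-oo, 1])).
    apply: measurableI; rewrite -[X in measurable X]setTI.
      exact: mf1.
    by apply: measurable_funD.
  apply/seteqP; split=> -[s t]; rewrite /H /I /f1 /= !in_itv /= => -[-> h];
    by split=> //; lra.
have := @indic_fubini_tonelli _ _ _ _ _ lebesgue_measure (lebesgue_tuple m) _ mH.
rewrite indic_fubini_tonelli_FE // indic_fubini_tonelli_GE //= => E.
transitivity (\int[lebesgue_tuple m]_t lebesgue_measure (ysection H t))%E.
  apply: eq_integral => t _; rewrite /tent.
  have -> : ysection H t = I `&` `]-oo, 1 - Q t]%classic.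
    apply/seteqP; split=> s; rewrite /ysection /I /= inE /H /= !in_itv /= => -[-> h];
      by split=> //; lra.
  have [Q0'|Q0'] := eqVneq (Q t) 0.
    rewrite Q0' subr0 setIidl; last first.
      by move=> s /=; rewrite /I /= !in_itv /= => /andP[_ /ltW].
    by rewrite lI max_r.
  have Qp : 0 < Q t by rewrite lt_neqAle eq_sym Q0' Q0.
  have -> : I `&` `]-oo, 1 - Q t]%classic = `[0, 1 - Q t]%classic.
    apply/seteqP; split=> s /=; rewrite /I /= !in_itv /=.
      by move=> -[/andP[-> _] ->].
    by move=> /andP[-> h]; split=> //=; lra.
  rewrite lebesgue_measure_itv /= lte_fin oppr0 adde0.
  by case: ltP.
rewrite -[LHS]E (_ : (fun x => _) = fun x => (((EFin \o w) \_ I) x *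
   lebesgue_tuple m (sublevel Q 1))%E); last first.
  apply/funext => s; rewrite patchE; case: ifPn => [|] hs.
    have {}hs : 0 <= s < 1 by move: hs; rewrite inE /I /= in_itv.
    rewrite /= -hQ; last by rewrite subr_gt0; case/andP: hs.
    congr (lebesgue_tuple m _); apply/seteqP; split=> t;
      rewrite /xsection /= inE /H /=; first by case.
    by split.
  rewrite mul0e (_ : xsection H s = set0) ?measure0 //.
  apply/seteqP; split=> t //; rewrite /xsection /= inE /H /= => -[h _].
  by move: hs; rewrite notin_setE /I /= in_itv /= h.
rewrite ge0_integralZr //.
- by rewrite -integral_mkcond.
- by apply/(measurable_restrictT _ _).1.
- by move=> s _; apply: erestrict_ge0 => ? _ /=; rewrite lee_fin.
Qed.

End layer_cake.

(** * Positive definite Hermitian forms *)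

Section sesquilinear.
Context {K : numFieldType} (theta : {rmorphism K -> K}) (n : nat).
Implicit Types (M : 'M[K]_n) (x y z : 'cV[K]_n).

Definition sesq M x y : K := (x^T *m M *m map_mx theta y) 0 0.

Lemma sesqE M x y : sesq M x y = \sum_i \sum_j x i 0 * M i j * theta (y j 0).
Proof.
rewrite /sesq mxE exchange_big /=; apply: eq_bigr => j _.
by rewrite !mxE mulr_suml; apply: eq_bigr => i _; rewrite mxE.
Qed.

Lemma sesqDl M x y z : sesq M (x + y) z = sesq M x z + sesq M y z.
Proof. by rewrite /sesq linearD /= !mulmxDl mxE. Qed.

Lemma sesqDr M x y z : sesq M x (y + z) = sesq M x y + sesq M x z.
Proof. by rewrite /sesq map_mxD mulmxDr mxE. Qed.

Lemma sesqDm M N x y : sesq (M + N) x y = sesq M x y + sesq N x y.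
Proof. by rewrite /sesq mulmxDr mulmxDl mxE. Qed.

Lemma sesqZm a M x y : sesq (a *: M) x y = a * sesq M x y.
Proof. by rewrite /sesq -scalemxAr -scalemxAl mxE. Qed.

Lemma sesqZl a M x y : sesq M (a *: x) y = a * sesq M x y.
Proof. by rewrite /sesq linearZ /= -!scalemxAl mxE. Qed.

Lemma sesqZr a M x y : sesq M x (a *: y) = theta a * sesq M x y.
Proof. by rewrite /sesq map_mxZ -scalemxAr mxE. Qed.

Lemma quadformD M x y : quadform theta M (x + y) =
  quadform theta M x + quadform theta M y + (sesq M x y + sesq M y x).
Proof.
by rewrite -![quadform _ _ _]/(sesq _ _ _) !sesqDl !sesqDr; ring.
Qed.

Lemma quadformDm M N x :
  quadform theta (M + N) x = quadform theta M x + quadform theta N x.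
Proof. exact: sesqDm. Qed.

Lemma quadformZm a M x : quadform theta (a *: M) x = a * quadform theta M x.
Proof. exact: sesqZm. Qed.

Lemma quadform0 M : quadform theta M 0 = 0.
Proof.
rewrite -[LHS]/(sesq M 0 0) sesqE big1 // => i _; rewrite big1 // => j _.
by rewrite !mxE !mul0r.
Qed.

Lemma posdefmx_ge0 M x : posdefmx theta M -> 0 <= quadform theta M x.
Proof.
by move=> [_ M0]; have [->|/M0/ltW//] := eqVneq x 0; rewrite quadform0.
Qed.

Lemma posdefmx_le0 M x : posdefmx theta M -> quadform theta M x <= 0 -> x = 0.
Proof.
by move=> [_ M0] qx; apply/eqP/negP => /negP/M0/lt_le_trans/(_ qx); rewrite ltxx.
Qed.

Lemma posdefmx_unit M : posdefmx theta M -> M \in unitmx.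
Proof.
move=> [_ M0]; rewrite unitmxE unitfE; apply/det0P => -[v v0 vM].
have /M0 : v^T != 0 by rewrite trmx_eq0.
by rewrite /quadform trmxK vM mul0mx mxE ltxx.
Qed.

Lemma hermitianP M :
  reflect (M = (map_mx theta M)^T) (M \is hermitianmx n false theta).
Proof.
by apply: (iffP (is_hermitianmxP _ _ _)); rewrite expr0 scale1r map_trmx.
Qed.

Lemma posdefmxD M N : posdefmx theta M -> posdefmx theta N ->
  posdefmx theta (M + N).
Proof.
move=> [/hermitianP hM M0] [/hermitianP hN N0]; split.
  by apply/hermitianP; rewrite map_mxD linearD /= -hM -hN.
by move=> x x0; rewrite quadformDm addr_gt0 ?M0 ?N0.
Qed.

Lemma posdefmxZ a M : theta a = a -> 0 < a -> posdefmx theta M ->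
  posdefmx theta (a *: M).
Proof.
move=> ta a0 [/hermitianP hM M0]; split.
  by apply/hermitianP; rewrite map_mxZ linearZ /= ta -hM.
by move=> x x0; rewrite quadformZm mulr_gt0 ?M0.
Qed.

Context (thetaK : involutive theta).

Lemma sesqC M x y : M \is hermitianmx n false theta ->
  sesq M y x = theta (sesq M x y).
Proof.
move=> /hermitianP hM; rewrite !sesqE exchange_big rmorph_sum /=.
apply: eq_bigr => i _; rewrite rmorph_sum; apply: eq_bigr => j _ /=.
have -> : M j i = theta (M i j) by rewrite {1}hM !mxE.
by rewrite !rmorphM thetaK; ring.
Qed.

Lemma theta_quadform M x : M \is hermitianmx n false theta ->
  theta (quadform theta M x) = quadform theta M x.
Proof. by move=> hM; rewrite [RHS](sesqC x x hM). Qed.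

(** Completing the square.  The centre [c] is the critical point of the left-hand
    side, that is, the solution of [M1 (c - c1)^* + M2 (c - c2)^* = 0], where the
    star is the conjugation [theta]; this makes all cross terms vanish. *)
Lemma average_quadform (M1 M2 : 'M[K]_n) (c1 c2 : 'cV[K]_n) :
  posdefmx theta M1 -> posdefmx theta M2 ->
  exists c : 'cV[K]_n, forall x,
    quadform theta M1 (x - c1) + quadform theta M2 (x - c2) =
    quadform theta (M1 + M2) (x - c) +
    (quadform theta M1 (c - c1) + quadform theta M2 (c - c2)).
Proof.
move=> p1 p2; have [h1 _] := p1; have [h2 _] := p2.
pose b := M1 *m map_mx theta c1 + M2 *m map_mx theta c2.
pose c := map_mx theta (invmx (M1 + M2) *m b).
have thc : map_mx theta c = invmx (M1 + M2) *m b.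
  by rewrite /c -map_mx_comp; apply/matrixP => i j; rewrite mxE /= thetaK.
have crossl h : sesq M1 h (c - c1) + sesq M2 h (c - c2) = 0.
  transitivity ((h^T *m (M1 *m map_mx theta (c - c1) +
                         M2 *m map_mx theta (c - c2))) 0 0).
    by rewrite mulmxDr !mulmxA [RHS]mxE.
  rewrite !map_mxB thc !mulmxBr addrACA -opprD.
  rewrite -mulmxDl mulKVmx ?subrr ?mulmx0 ?mxE //.
  exact: posdefmx_unit (posdefmxD p1 p2).
have crossr h : sesq M1 (c - c1) h + sesq M2 (c - c2) h = 0.
  by rewrite (sesqC _ _ h1) (sesqC _ _ h2) -rmorphD crossl rmorph0.
exists c => x.
have split_ d : x - d = (x - c) + (c - d) by rewrite addrA subrK.
rewrite (split_ c1) (split_ c2) quadformDm.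
have := crossl (x - c); have := crossr (x - c).
rewrite (quadformD M1 (x - c) (c - c1)) (quadformD M2 (x - c) (c - c2)).
set q1 := quadform _ _ _; set q2 := quadform _ _ _; set q3 := quadform _ _ _.
set q4 := quadform _ _ _.
set s1 := sesq _ _ _; set s2 := sesq _ _ _; set s3 := sesq _ _ _.
set s4 := sesq _ _ _ => e1 e2.
transitivity (q1 + q3 + (q2 + q4) + ((s3 + s4) + (s1 + s2))); first by ring.
by rewrite e1 e2 !addr0.
Qed.

End sesquilinear.

(** * Sublevel sets of real quadratic forms *)

Section real_quadform.
Context {R : realType} (m : nat).
Local Notation T := (measurableTypeR R).
Implicit Types (N : 'M[R]_m) (x y h : 'cV[R]_m).
Local Notation B := (@sesq R idfun m).

Definition tuple_col (t : m.-tuple T) : 'cV[R]_m := \col_i tnth t i.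

Lemma quadformZ N (a : R) x :
  quadform idfun N (a *: x) = a ^+ 2 * quadform idfun N x.
Proof.
by rewrite -[LHS]/(B N _ _) sesqZl sesqZr mulrA expr2.
Qed.

(** Cauchy-Schwarz for the form [N], applied to [x] and to the vector [u] with
    [N u = e_i]: the [N]-product of [x] and [u] is [x_i], and that of [u] with
    itself is the [i]-th diagonal coefficient of the inverse.  It bounds the
    ellipsoid of [N]. *)
Lemma posdefmx_coord N x i : posdefmx idfun N ->
  x i 0 ^+ 2 <= quadform idfun N x * invmx N i i.
Proof.
move=> pN; have [hN _] := pN; have uN := posdefmx_unit pN.
pose u : 'cV[R]_m := col i (invmx N).
have Nu : N *m u = delta_mx i 0.
  by rewrite /u colE mulmxA mulmxV // mul1mx.
have Bxu z : B N z u = z i 0.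
  rewrite /sesq (_ : map_mx idfun u = u); last first.
    by apply/matrixP => j k; rewrite mxE.
  by rewrite -mulmxA Nu -colE !mxE.
have Bux z : B N u z = z i 0 by rewrite (@sesqC R idfun _ _ N z u) // Bxu.
have qu0 : 0 < quadform idfun N u.
  case: pN => _; apply; apply/eqP => u0; move: Nu; rewrite u0 mulmx0.
  move/matrixP => /(_ i 0); rewrite !mxE !eqxx /= => /eqP.
  by rewrite eq_sym oner_eq0.
have qE z : quadform idfun N z = B N z z by [].
have -> : invmx N i i = quadform idfun N u by rewrite qE Bxu mxE.
set a := quadform idfun N u; set b := x i 0.
(* The value of the form at [a x - b u] is [a (a q(x) - b ^ 2)]. *)
have := posdefmx_ge0 (a *: x + (- b) *: u) pN.
rewrite (@quadformD R idfun) !quadformZ !sesqZl !sesqZr Bxu Bux -/a -/b.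
move=> h; have {}h : 0 <= a * (quadform idfun N x * a - b ^+ 2).
  by apply: le_trans h _; rewrite le_eqVlt; apply/orP; left; apply/eqP => /=; ring.
by rewrite -subr_ge0 -(pmulr_rge0 _ qu0).
Qed.

Lemma sesq_bound N (a b : R) x y : 0 <= a -> 0 <= b ->
  (forall i, `|x i 0| <= a) -> (forall i, `|y i 0| <= b) ->
  `|B N x y| <= a * b * \sum_i \sum_j `|N i j|.
Proof.
move=> a0 b0 xa yb; rewrite sesqE mulr_sumr.
apply: le_trans (ler_norm_sum _ _ _) _; apply: ler_sum => i _.
rewrite mulr_sumr; apply: le_trans (ler_norm_sum _ _ _) _.
apply: ler_sum => j _; rewrite /= !normrM mulrAC ler_wpM2r //.
by rewrite ler_pM.
Qed.

(** Local Lipschitz estimate at [x], in a form that produces cubes directly. *)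
Lemma quadform_near N x : exists2 C : R, 0 <= C & forall (d : R) h,
  0 <= d <= 1 -> (forall i, `|h i 0| <= d) ->
  `|quadform idfun N (x + h) - quadform idfun N x| <= d * C.
Proof.
pose a := \sum_i `|x i 0|; pose S := \sum_i \sum_j `|N i j|.
have a0 : 0 <= a by apply: sumr_ge0.
have S0 : 0 <= S by apply: sumr_ge0 => i _; apply: sumr_ge0.
have xa i : `|x i 0| <= a by rewrite /a (bigD1 i) //= lerDl sumr_ge0.
exists ((1 + a *+ 2) * S); first by rewrite mulr_ge0 // addr_ge0 // mulrn_wge0.
move=> d h /andP[d0 d1] hd.
rewrite (@quadformD R idfun) addrC !addrA addNr add0r.
have := sesq_bound N d0 d0 hd hd; have := sesq_bound N a0 d0 xa hd.
have := sesq_bound N d0 a0 hd xa; rewrite -/S => h1 h2 h3.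
apply: le_trans (ler_normD _ _) _; apply: le_trans (lerD (ler_normD _ _) (lexx _)) _.
apply: le_trans (lerD (lerD h3 h2) h1) _.
rewrite -!mulrDl mulrA ler_wpM2r //.
have -> : (d + a) * d + d * a = d * (d + a + a) by ring.
by rewrite ler_wpM2l // !lerD2r.
Qed.

Lemma measurable_tuple_quadform N :
  measurable_fun setT (fun t => quadform idfun N (tuple_col t)).
Proof.
rewrite (_ : (fun t => _) = fun t : m.-tuple T => \sum_(i <- index_enum 'I_m)
  \sum_(j <- index_enum 'I_m) (tnth t i : R) * N i j * (tnth t j : R)).
  have mt k : measurable_fun setT (fun t : m.-tuple T => tnth t k : R).
    exact: measurable_tnth.
  apply: measurable_sum => i; apply: measurable_sum => j.
  by apply: measurable_funM => //; apply: measurable_funM.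
apply/funext => t; rewrite -[LHS]/(B N _ _) sesqE.
by apply: eq_bigr => i _; apply: eq_bigr => j _; rewrite !mxE.
Qed.

Lemma measurable_sublevel (f : m.-tuple T -> R) r : measurable_fun setT f ->
  measurable (sublevel f r).
Proof.
move=> mf; rewrite (_ : sublevel f r = f @^-1` `]-oo, r]).
  by rewrite -[X in measurable X]setTI; apply: mf.
by apply/seteqP; split=> t; rewrite /sublevel /= in_itv.
Qed.

Lemma volumeE (E : set 'cV[R]_m) : volume E = lebesgue_tuple m (tuple_col @^-1` E).
Proof. by []. Qed.

Lemma volume_sublevel_shift N c r :
  volume [set x | quadform idfun N (x - c) <= r] =
  volume (sublevel (quadform idfun N) r).
Proof.
rewrite [RHS]volumeE (@lebesgue_tuple_affine _ m 1 (fun i => - c i 0)) //.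
  rewrite expr1n mul1e volumeE; congr (lebesgue_tuple m _).
  apply/seteqP; split=> t; rewrite /sublevel /=; congr (quadform _ _ _ <= _);
    by apply/matrixP => i j; rewrite !mxE tnth_mktuple mul1r (ord1 j).
exact: measurable_sublevel (measurable_tuple_quadform _).
Qed.

Lemma volume_sublevel_scale N r : 0 < r ->
  volume (sublevel (quadform idfun N) r) =
  ((Num.sqrt r ^+ m)%:E * volume (sublevel (quadform idfun N) 1))%E.
Proof.
move=> r0; have s0 : 0 < Num.sqrt r by rewrite sqrtr_gt0.
rewrite [LHS]volumeE (@lebesgue_tuple_affine _ m (Num.sqrt r) (fun i => 0)) //.
  congr (_ * _)%E; rewrite volumeE; congr (lebesgue_tuple m _).
  have E t : quadform idfun N (tuple_col (affine_tuple (Num.sqrt r) (fun=> 0) t)) =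
      r * quadform idfun N (tuple_col t).
    rewrite -[in RHS](sqr_sqrtr (ltW r0)) -quadformZ; congr quadform.
    by apply/matrixP => i j; rewrite !mxE tnth_mktuple addr0.
  by apply/seteqP; split=> t; rewrite /sublevel /= E ger_pMr.
exact: measurable_sublevel (measurable_tuple_quadform _).
Qed.

Lemma le_volume (E F : set 'cV[R]_m) :
  measurable (tuple_col @^-1` E) -> measurable (tuple_col @^-1` F) ->
  E `<=` F -> (volume E <= volume F)%E.
Proof.
by move=> mE mF EF; apply: le_measure; rewrite ?inE // => t; exact: EF.
Qed.

(** Defined by the coordinates of [y - x], the increment to which
    [quadform_near] applies. *)
Definition cube x (d : R) : set 'cV[R]_m := [set y | forall i, `|(y - x) i 0| <= d].

Lemma volume_cube x (d : R) : 0 <= d ->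
  volume (cube x d) = ((d *+ 2) ^+ m)%:E.
Proof.
move=> d0; rewrite volumeE.
have := @lebesgue_tuple_box R m (fun i => x i 0 - d) (fun i => x i 0 + d).
rewrite (eq_bigr (fun=> d *+ 2)); last by move=> i _; rewrite mulr2n; ring.
rewrite prodr_const card_ord => <-; last by move=> i; lra.
congr (lebesgue_tuple m _); apply/seteqP; split=> t /= h i; have := h i;
  by rewrite !mxE ler_distl.
Qed.

Lemma measurable_cube x (d : R) :
  measurable (tuple_col @^-1` cube x d).
Proof.
rewrite (_ : _ @^-1` _ = \bigcap_(i in [set: 'I_m])
    (tnth (T := T)^~ i @^-1` `[x i 0 - d, x i 0 + d])); last first.
  apply/seteqP; split=> t /= h i; first by
    move=> _; have := h i; rewrite !mxE ler_distl /= in_itv.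
  by have := h i I; rewrite /= in_itv /= !mxE ler_distl.
apply: fin_bigcap_measurable => // i _.
rewrite -[X in measurable X]setTI; exact: (measurable_tnth (T := T)).
Qed.

Lemma volume_sublevel_lty N : posdefmx idfun N ->
  (volume (sublevel (quadform idfun N) 1) < +oo)%E.
Proof.
move=> pN; pose d := \sum_i (`|invmx N i i| + 1).
have d0 : 0 <= d by apply: sumr_ge0 => i _; rewrite addr_ge0.
apply: (@le_lt_trans _ _ (volume (cube 0 d))).
  apply: le_volume.
  - exact: measurable_sublevel (measurable_tuple_quadform _).
  - exact: measurable_cube.
  move=> y; rewrite /sublevel /= => qt i; rewrite subr0.
  have := posdefmx_coord y i pN; rewrite -real_normK ?num_real //.
  have q0 := posdefmx_ge0 y pN.
  have : `|invmx N i i| + 1 <= d.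
    by rewrite /d (bigD1 i) //= lerDl sumr_ge0 // => j _; rewrite addr_ge0.
  have := ler_norm (invmx N i i); have := normr_ge0 (invmx N i i).
  have := normr_ge0 (y i 0).
  set a := `|y i 0|; set b := `|_|; set b' := invmx _ _ _ => a0 b0 bb' bd aq.
  rewrite leNgt; apply/negP => da.
  have : quadform idfun N y * b' <= b.
    apply: le_trans (ler_wpM2l q0 bb') _; rewrite -[leRHS]mul1r.
    exact: ler_wpM2r.
  nra.
by rewrite volume_cube // ltry.
Qed.

Lemma volume_sublevel_gt0 N : (0 < volume (sublevel (quadform idfun N) 1))%E.
Proof.
have [C C0 hC] := quadform_near N 0.
pose d := (C + 1)^-1.
have C1 : 0 < C + 1 by rewrite ltr_wpDl.
have d0 : 0 < d by rewrite invr_gt0.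
have d1 : d <= 1 by rewrite invf_le1 // lerDr.
apply: (@lt_le_trans _ _ (volume (cube 0 d))).
  by rewrite volume_cube ?ltW // lte_fin exprn_gt0 // mulrn_wgt0.
apply: le_volume.
- exact: measurable_cube.
- exact: measurable_sublevel (measurable_tuple_quadform _).
move=> y; rewrite /sublevel /= => ht.
have := hC d y; rewrite (ltW d0) d1 => /(_ isT).
have : forall i, `|y i 0| <= d by move=> i; have := ht i; rewrite subr0.
move=> /[swap] /[apply]; rewrite add0r (@quadform0 R idfun) subr0.
move=> /(le_trans (ler_norm _)) /le_trans; apply.
by rewrite /d mulrC ler_pdivrMr // mul1r lerDl.
Qed.

End real_quadform.

(** * The volume of an averaged ellipsoid *)

Section midpoint.
Context {R : realType} (m : nat).
Local Notation T := (measurableTypeR R).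
Implicit Types (N : 'M[R]_m) (x y h : 'cV[R]_m).
Local Notation mu := (lebesgue_tuple (R := R) m).

Lemma tent_ge0 (u : R) : 0 <= tent u.
Proof. by rewrite /tent le_max lexx. Qed.

Lemma tent_le (u v : R) : 0 <= v -> 1 - u <= v -> tent u <= v.
Proof. by move=> v0 uv; rewrite /tent ge_max v0. Qed.

Lemma tent_midpoint (a b : R) : tent ((a + b) / 2) <= (tent a + tent b) / 2.
Proof.
have := tent_ge0 a; have := tent_ge0 b.
have : 1 - a <= tent a by rewrite le_max lexx orbT.
have : 1 - b <= tent b by rewrite le_max lexx orbT.
by move=> *; apply: tent_le; lra.
Qed.

(** The graph of [tent] bends at [1], so convexity is strict by a definite amount
    for two points that stay away from [1] on opposite sides. *)
Lemma tent_midpoint_gap (a b e : R) : a <= 1 - e *+ 2 -> 1 + e *+ 2 <= b ->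
  0 <= e -> tent ((a + b) / 2) + e <= (tent a + tent b) / 2.
Proof.
have := tent_ge0 b.
have : 1 - a <= tent a by rewrite le_max lexx orbT.
by move=> *; rewrite -lerBrDr; apply: tent_le; lra.
Qed.

(** Both forms are homogeneous of degree 2, so at a suitable multiple of [x] the
    value 1 lies strictly between them; [quadform_near] spreads this to a cube. *)
Lemma separating_cube N1 N2 x : posdefmx idfun N1 ->
  quadform idfun N1 x < quadform idfun N2 x ->
  exists y d e, [/\ 0 < d, 0 < e & forall z, cube y d z ->
    quadform idfun N1 z <= 1 - e *+ 2 /\ 1 + e *+ 2 <= quadform idfun N2 z].
Proof.
move=> p1 q12; have q1 := posdefmx_ge0 x p1.
(* The average of the two forms at [y] is 1. *)
pose y := Num.sqrt (2 / (quadform idfun N1 x + quadform idfun N2 x)) *: x.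
have yE N : quadform idfun N y =
    2 / (quadform idfun N1 x + quadform idfun N2 x) * quadform idfun N x.
  by rewrite quadformZ sqr_sqrtr // divr_ge0 //; lra.
have y1 : quadform idfun N1 y < 1.
  by rewrite yE mulrAC ltr_pdivrMr ?mul1r; lra.
have y2 : 1 < quadform idfun N2 y.
  by rewrite yE mulrAC ltr_pdivlMr ?mul1r; lra.
have [C1 C10 h1] := quadform_near N1 y.
have [C2 C20 h2] := quadform_near N2 y.
pose e := Num.min (1 - quadform idfun N1 y) (quadform idfun N2 y - 1) / 4.
have e0 : 0 < e by rewrite divr_gt0 // lt_min !subr_gt0 y1 y2.
have e1 : quadform idfun N1 y <= 1 - 4 * e.
  have : 4 * e <= 1 - quadform idfun N1 y by rewrite mulrC divfK // ge_min lexx.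
  lra.
have e2 : 1 + 4 * e <= quadform idfun N2 y.
  have : 4 * e <= quadform idfun N2 y - 1.
    by rewrite mulrC divfK // ge_min lexx orbT.
  lra.
pose d := Num.min 1 (e *+ 2 / (C1 + C2 + 1)).
have C0 : 0 < C1 + C2 + 1 by lra.
have d0 : 0 < d by rewrite lt_min ltr01 divr_gt0 // mulrn_wgt0.
have d01 : 0 <= d <= 1 by rewrite (ltW d0) ge_min lexx.
have dC : d * (C1 + C2 + 1) <= e *+ 2.
  by rewrite -ler_pdivlMr // ge_min lexx orbT.
exists y, d, e; split=> // z zy.
have zE : y + (z - y) = z by rewrite addrC subrK.
have := h1 d (z - y) d01 zy; have := h2 d (z - y) d01 zy.
rewrite zE !ler_distl => /andP[k1 k2] /andP[k3 k4].
have dC1 : 0 <= d * C1 by rewrite mulr_ge0 // ltW.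
have dC2 : 0 <= d * C2 by rewrite mulr_ge0 // ltW.
have := ltW d0; move: dC; rewrite !mulrDr mulr1 => dC dd.
by split; lra.
Qed.

(** Integrate the midpoint convexity of [tent], improved by [e] on the cube where
    the two forms are separated by [1], and read each integral as a volume. *)
Lemma volume_midpoint_lt N1 N2 N x :
  posdefmx idfun N1 -> posdefmx idfun N2 -> posdefmx idfun N ->
  (forall y, quadform idfun N y =
     (quadform idfun N1 y + quadform idfun N2 y) / 2) ->
  quadform idfun N1 x < quadform idfun N2 x ->
  volume (sublevel (quadform idfun N1) 1) =
    volume (sublevel (quadform idfun N2) 1) ->
  (volume (sublevel (quadform idfun N) 1) <
   volume (sublevel (quadform idfun N1) 1))%E.
Proof.
move=> p1 p2 p qN q12 v12.
have [y [d [e [d0 e0 sep]]]] := separating_cube p1 q12.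
have [c [c0 c1 layer]] := @integral_tent R m.
pose D : set (m.-tuple T) := @tuple_col R m @^-1` cube y d.
have mD : measurable D by exact: measurable_cube.
pose f (P : 'M[R]_m) (t : m.-tuple T) : R :=
  tent (quadform idfun P (tuple_col t)).
have f0 P t : 0 <= f P t by exact: tent_ge0.
have mf P : measurable_fun setT (f P).
  apply: measurable_maxr => //; apply: measurable_funB => //.
  exact: measurable_tuple_quadform.
pose I P := (\int[mu]_t (f P t)%:E)%E.
have IE P : posdefmx idfun P ->
    I P = (c * volume (sublevel (quadform idfun P) 1))%E.
  move=> pP; apply: layer.
  - exact: measurable_tuple_quadform.
  - by move=> t; exact: posdefmx_ge0.
  - by move=> r r0; exact: (volume_sublevel_scale P r0).
have Ihalf P : (2^-1%:E * I P = \int[mu]_t (2^-1 * f P t)%:E)%E.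
  rewrite -ge0_integralZl //; last 2 first.
  - exact/measurable_EFinP.
  - by move=> t _; rewrite lee_fin.
have Ie : (e%:E * mu D = \int[mu]_t (e * \1_D t)%:E)%E.
  under [RHS]eq_integral do rewrite EFinM.
  rewrite ge0_integralZl //; last 2 first.
  - by apply/measurable_EFinP; exact: measurable_indic.
  - by rewrite lee_fin ltW.
  by rewrite integral_indic // setIT.
have mhalf P : measurable_fun setT (fun t => (2^-1 * f P t)%:E).
  by apply/measurable_EFinP; exact: measurable_funM.
have me : measurable_fun setT (fun t => (e * \1_D t)%:E).
  by apply/measurable_EFinP; apply: measurable_funM => //; exact: measurable_indic.
have mfE P : measurable_fun setT (fun t => (f P t)%:E) by exact/measurable_EFinP.
have half0 P t : (0 <= (2^-1 * f P t)%:E)%E by rewrite lee_fin mulr_ge0.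
have e1D t : (0 <= (e * \1_D t)%:E)%E by rewrite lee_fin mulr_ge0 ?(ltW e0).
have Ile : (I N + e%:E * mu D <= 2^-1%:E * I N1 + 2^-1%:E * I N2)%E.
  rewrite !Ihalf Ie -!ge0_integralD //; last by move=> t _; rewrite lee_fin.
  apply: ge0_le_integral => //.
  - by move=> t _; rewrite adde_ge0 // lee_fin.
  - exact: emeasurable_funD.
  - exact: emeasurable_funD.
  move=> t _; rewrite -!EFinD lee_fin /f qN -mulrDr [leRHS]mulrC.
  rewrite indicE; case: (boolP (t \in D)) => [|_].
    rewrite inE => /sep[s1 s2]; rewrite mulr1.
    exact: tent_midpoint_gap (ltW e0).
  by rewrite mulr0 addr0 tent_midpoint.
move: Ile; rewrite !IE // -v12 ltNge => Ile; apply/negP => vle.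
have v_fin : (volume (sublevel (quadform idfun N1) 1) \is a fin_num)%E.
  by rewrite ge0_fin_numE ?measure_ge0 //; exact: volume_sublevel_lty.
have c_fin : (c \is a fin_num)%E.
  by rewrite ge0_fin_numE //; apply: le_lt_trans c1 _; exact: ltry.
have muD : mu D = ((d *+ 2) ^+ m)%:E by rewrite -[LHS]volumeE volume_cube // ltW.
have {vle} : (c * volume (sublevel (quadform idfun N1) 1) <=
    c * volume (sublevel (quadform idfun N) 1))%E by exact: lee_wpmul2l.
move=> /(leeD2r (e%:E * mu D)%E) /le_trans /(_ Ile); rewrite muD.
rewrite -(fineK v_fin) -(fineK c_fin) -!EFinM -!EFinD lee_fin.
have : 0 < e * (d *+ 2) ^+ m by rewrite mulr_gt0 // exprn_gt0 // mulrn_wgt0.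
set k := fine _ * fine _ => *; lra.
Qed.

End midpoint.

(** * Uniqueness over a field with a real structure *)

Section MiCE_uniqueness.
Context {R : realType} {K : numFieldType} (theta : {rmorphism K -> K}).
Context (emb : {rmorphism R -> K}) (n m : nat).
Context (toR : 'cV[K]_n -> 'cV[R]_m) (ofR : 'cV[R]_m -> 'cV[K]_n).
Context (thetaK : involutive theta) (emb_le : {mono emb : a b / a <= b}).
Context (ofRK : cancel ofR toR) (toRB : {morph toR : x y / x - y}).
Context (toR_quadform : forall M, posdefmx theta M ->
  exists2 N, posdefmx idfun N &
    forall x, quadform theta M x = emb (quadform idfun N (toR x))).
Context (m_gt0 : (0 < m)%N).

Lemma ellipsoidE (M : 'M[K]_n) c :
  [set c + x | x in [set x | quadform theta M x <= 1]] =
  [set y | quadform theta M (y - c) <= 1].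
Proof.
apply/seteqP; split=> y /=.
  by move=> [x qx <-]; rewrite addrC addKr.
by move=> qy; exists (y - c); rewrite // addrC subrK.
Qed.

Lemma volume_toR_ball (M : 'M[K]_n) N c r :
  (forall x, quadform theta M x = emb (quadform idfun N (toR x))) ->
  volume (toR @` [set y | quadform theta M (y - c) <= emb r]) =
  volume (sublevel (quadform idfun N) r).
Proof.
move=> MN; rewrite -(volume_sublevel_shift N (toR c)); congr volume.
apply/seteqP; split=> y /=.
  by move=> [x + <-]; rewrite MN emb_le toRB.
by move=> qy; exists (ofR y); rewrite ?ofRK // MN emb_le toRB ofRK.
Qed.

Lemma non_flat_nontrivial (A : set 'cV[K]_n) c : non_flat (toR @` A) ->
  ~ A `<=` [set c].
Proof.
move=> nfA Ac; apply: (nfA (const_mx 1) (((const_mx 1 : 'cV[R]_m)^T *m toR c) 0 0)).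
  apply/eqP => /matrixP /(_ (Ordinal m_gt0) 0); rewrite !mxE => /eqP.
  by rewrite oner_eq0.
by move=> _ [x /Ac -> <-].
Qed.

(** Forms are averaged in K^n, so that the competitor is an ellipsoid over K and
    minimality applies to it, but volumes are compared in R^m through [toR], where
    Lebesgue measure lives. *)
Theorem MiCE_unique (A E1 E2 : set 'cV[K]_n) : non_flat (toR @` A) ->
  is_MiCE theta (fun F => volume (toR @` F)) A E1 ->
  is_MiCE theta (fun F => volume (toR @` F)) A E2 -> E1 = E2.
Proof.
move=> nfA [ellE1 AE1 min1] [ellE2 AE2 min2].
have v12 : volume (toR @` E1) = volume (toR @` E2).
  by apply/eqP; rewrite eq_le min1 // min2.
have [M1 [c1 [pM1 E1E]]] := ellE1; have [M2 [c2 [pM2 E2E]]] := ellE2.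
rewrite ellipsoidE in E1E; rewrite ellipsoidE in E2E.
have [N1 pN1 MN1] := toR_quadform pM1; have [N2 pN2 MN2] := toR_quadform pM2.
have th2 : theta 2^-1 = 2^-1 by rewrite fmorphV rmorph_nat.
have pM : posdefmx theta (2^-1 *: (M1 + M2)).
  by apply: posdefmxZ; rewrite ?invr_gt0 //; exact: posdefmxD.
set M := 2^-1 *: (M1 + M2) in pM.
have [N pN MN] := toR_quadform pM.
have qN y : quadform idfun N y =
    (quadform idfun N1 y + quadform idfun N2 y) / 2.
  apply: (fmorph_inj emb); rewrite -[y]ofRK -MN quadformZm quadformDm MN1 MN2.
  by rewrite rmorphM rmorphD fmorphV rmorph_nat mulrC.
have [c avg] := average_quadform thetaK c1 c2 pM1 pM2.
pose s : R := (quadform idfun N1 (toR (c - c1)) + quadform idfun N2 (toR (c - c2))) / 2.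
have s0 : 0 <= s by rewrite divr_ge0 // addr_ge0 // posdefmx_ge0.
have embs : emb s = 2^-1 * (quadform theta M1 (c - c1) + quadform theta M2 (c - c2)).
  by rewrite rmorphM rmorphD fmorphV rmorph_nat mulrC MN1 MN2.
have emb1s : emb (1 - s) = 1 - emb s by rewrite rmorphB rmorph1.
have AM x : A x -> quadform theta M (x - c) <= emb (1 - s).
  move=> Ax; have := AE1 _ Ax; have := AE2 _ Ax; rewrite E1E E2E /= => h2 h1.
  rewrite emb1s embs lerBrDr quadformZm -mulrDr -avg.
  by rewrite mulrC ler_pdivrMr // mul1r -[2]/(1 + 1) lerD.
(* Otherwise the competitor is at most a point, and [A] would be flat. *)
have s1 : s < 1.
  rewrite ltNge; apply/negP => s1; apply: (non_flat_nontrivial nfA (c := c)) => x Ax /=.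
  apply/eqP; rewrite -subr_eq0; apply/eqP/(posdefmx_le0 pM).
  apply: le_trans (AM _ Ax) _; rewrite -(rmorph0 emb) emb_le; lra.
have t0 : 0 < 1 - s by rewrite subr_gt0.
pose E : set 'cV[K]_n := [set y | quadform theta M (y - c) <= emb (1 - s)].
have ths : theta (emb s) = emb s.
  have [h1 _] := pM1; have [h2 _] := pM2.
  by rewrite embs rmorphM rmorphD !theta_quadform // th2.
have et0 : 0 < emb (1 - s).
  by rewrite lt_neqAle eq_sym fmorph_eq0 gt_eqF // -(rmorph0 emb) emb_le ltW.
have ellE : ellipsoid theta E.
  exists ((emb (1 - s))^-1 *: M), c; split.
    apply: posdefmxZ; rewrite ?invr_gt0 //.
    by rewrite fmorphV emb1s rmorphB rmorph1 ths.
  rewrite ellipsoidE; apply/seteqP; split=> y /=; rewrite quadformZm mulrC;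
  by rewrite ler_pdivrMr // mul1r.
have := min1 _ ellE AM.
have vE1 : volume (toR @` E1) = volume (sublevel (quadform idfun N1) 1).
  by rewrite E1E -(volume_toR_ball c1 1 MN1) rmorph1.
have vE2 : volume (toR @` E2) = volume (sublevel (quadform idfun N2) 1).
  by rewrite E2E -(volume_toR_ball c2 1 MN2) rmorph1.
have v12' : volume (sublevel (quadform idfun N1) 1) =
    volume (sublevel (quadform idfun N2) 1) by rewrite -vE1 -vE2.
rewrite vE1 (volume_toR_ball c (1 - s) MN) (volume_sublevel_scale N t0).
have sq1 : Num.sqrt (1 - s) <= 1 by rewrite -[leRHS]sqrtr1 ler_wsqrtr // lerBlDr lerDl.
(* Distinct forms: the competitor is smaller even before it is shrunk by [s]. *)
have [[y q12]|q12] := pselect (exists y, quadform idfun N1 y <> quadform idfun N2 y).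
  have vlt : (volume (sublevel (quadform idfun N) 1) <
      volume (sublevel (quadform idfun N1) 1))%E.
    have [q12'|q21'|//] := ltgtP (quadform idfun N1 y) (quadform idfun N2 y).
      exact: volume_midpoint_lt q12' v12'.
    rewrite v12'; apply: volume_midpoint_lt q21' _ => //.
    by move=> z; rewrite qN addrC.
  rewrite leNgt => /negP[]; apply: le_lt_trans vlt.
  rewrite -[leRHS]mul1e; apply: lee_wpmul2r; first exact: ltW (volume_sublevel_gt0 N).
  by rewrite lee_fin exprn_ile1 ?sqrtr_ge0.
have {}q12 y : quadform idfun N1 y = quadform idfun N2 y.
  by apply: contrapT => h; apply: q12; exists y.
have -> : quadform idfun N = quadform idfun N1.
  by apply/funext => y; rewrite qN -q12; lra.
(* Equal forms: the competitor is a translate of E1 shrunk by [sqrt (1 - s)]. *)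
have v_gt0 := volume_sublevel_gt0 N1; have v_lty := volume_sublevel_lty pN1.
have v_fin : (volume (sublevel (quadform idfun N1) 1) \is a fin_num)%E.
  by rewrite ge0_fin_numE // ltW.
move=> vle.
have s_eq0 : s = 0.
  apply/eqP; rewrite eq_le s0 andbT leNgt; apply/negP => s_gt0.
  have : Num.sqrt (1 - s) ^+ m < 1.
    rewrite exprn_ilt1 ?sqrtr_ge0 -?lt0n //.
    by rewrite -[ltRHS]sqrtr1 ltr_sqrt // ltrBlDr ltrDl.
  rewrite ltNge => /negP; apply; move: vle v_gt0.
  rewrite -(fineK v_fin) -EFinM lee_fin lte_fin => + v0.
  by rewrite -[leLHS]mul1r ler_pM2r.
have /andP[/eqP q1 /eqP q2] : (quadform theta M1 (c - c1) == 0) &&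
    (quadform theta M2 (c - c2) == 0).
  rewrite -paddr_eq0 ?posdefmx_ge0 //.
  move: embs; rewrite s_eq0 rmorph0 => /esym/eqP.
  by rewrite mulf_eq0 invr_eq0 pnatr_eq0.
have cc1 : c = c1.
  by apply/eqP; rewrite -subr_eq0; apply/eqP/(posdefmx_le0 pM1); rewrite q1.
have cc2 : c = c2.
  by apply/eqP; rewrite -subr_eq0; apply/eqP/(posdefmx_le0 pM2); rewrite q2.
rewrite E1E E2E -cc1 -cc2; apply/seteqP.
by split=> y /=; rewrite MN1 MN2 q12.
Qed.

End MiCE_uniqueness.

(** * Hermitian forms on C^n as real quadratic forms *)

Section realification.
Context {R : realType} (n : nat).
Local Open Scope complex_scope.

Definition complexify (w : 'cV[R]_(n + n)) : 'cV[R[i]]_n :=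
  \col_i Complex (w (lshift n i) 0) (w (rshift n i) 0).

Lemma complexifyK : cancel complexify (@realify R n).
Proof.
move=> w; apply/matrixP => i j; rewrite (ord1 j) mxE.
by case: splitP => k ik; rewrite !mxE /=; congr (w _ _); exact: val_inj.
Qed.

Lemma realifyB : {morph @realify R n : x y / x - y}.
Proof.
by move=> x y; rewrite /realify opp_col_mx add_col_mx !raddfB.
Qed.

(** With M = P + i S, P symmetric and S antisymmetric, the form at u + i v is
    u^T P u + v^T P v + u^T S v - v^T S u. *)
Lemma realify_quadform (M : 'M[R[i]]_n) : posdefmx Num.conj M ->
  exists2 N : 'M[R]_(n + n), posdefmx idfun N &
    forall z, quadform Num.conj M z = (quadform idfun N (realify z))%:C.
Proof.
move=> pM; have [hM M0] := pM.
pose P := map_mx (@complex.Re R) M; pose S := map_mx (@complex.Im R) M.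
pose N := block_mx P S (- S) P.
have NE z : quadform Num.conj M z = (quadform idfun N (realify z))%:C.
  (* A Hermitian form is fixed by conjugation, so it remains to take real parts. *)
  have realq : complex.Im (quadform Num.conj M z) = 0.
    have := theta_quadform (@conjCK R[i]) z hM.
    case: (quadform _ _ _) => a b [] /eqP; rewrite eq_sym -addr_eq0 -mulr2n.
    by rewrite mulrn_eq0 => /eqP.
  rewrite [LHS]complexE realq mulr0 addr0; congr (_%:C).
  rewrite -[quadform Num.conj M z]/(sesq _ M z z) sesqE.
  rewrite -[RHS]/(@sesq R idfun _ N _ _) sesqE big_split_ord /= -big_split raddf_sum /=.
  apply: eq_bigr => i _; rewrite !big_split_ord /= -!big_split raddf_sum /=.
  apply: eq_bigr => j _.
  rewrite /N block_mxEul block_mxEur block_mxEdl block_mxEdr.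
  rewrite /realify !col_mxEu !col_mxEd.
  rewrite !mxE; case: (z i 0) (z j 0) (M i j) => a b [c d] [p q] /=.
  by ring.
exists N => //; split.
  have hM' i j : M i j = Num.conj (M j i) by rewrite {1}(hermitianP _ _ hM) !mxE.
  have PT : P^T = P.
    by apply/matrixP => i j; rewrite !mxE (hM' j i); case: (M i j).
  have ST : S^T = - S.
    by apply/matrixP => i j; rewrite !mxE (hM' j i); case: (M i j).
  have NT : N^T = N by rewrite tr_block_mx linearN /= PT ST opprK.
  by apply/hermitianP; rewrite -[LHS]NT; apply/matrixP => i j; rewrite !mxE.
move=> w w0; have : 0 < quadform Num.conj M (complexify w).
  apply: M0; apply: contra_neq w0 => cw0.
  rewrite -[w]complexifyK cw0; apply/matrixP => i j; rewrite !mxE.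
  by case: splitP => k _; rewrite !mxE.
by rewrite NE complexifyK -(rmorph0 (real_complex R)) ltcR.
Qed.

End realification.

(** * The minimal circumscribed ellipsoid *)

Theorem theorem5 (R : realType) (n : nat) (n_ge1 : (1 <= n)%N) :
  (forall A : set 'cV[R]_n,
      compact A -> non_flat A ->
      forall E1 E2 : set 'cV[R]_n,
        MiCE_real A E1 -> MiCE_real A E2 -> E1 = E2)
  /\
  (forall A : set 'cV[R[i] : numFieldType]_n,
      compact A -> non_flat (@realify R n @` A) ->
      forall E1 E2 : set 'cV[R[i]]_n,
        MiCE_complex A E1 -> MiCE_complex A E2 -> E1 = E2).
Proof.
split=> A _ nfA E1 E2.
  have E : @volume R n = fun F => volume (idfun @` F).
    by apply/funext => F; rewrite image_id.
  rewrite /MiCE_real E; apply: (MiCE_unique (emb := idfun) (toR := idfun)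
    (ofR := idfun)); rewrite ?image_id //.
  by move=> M pM; exists M.
apply: (MiCE_unique (emb := real_complex R) (ofR := @complexify R n)) nfA.
- exact: conjCK.
- by move=> a b; rewrite lecR.
- exact: complexifyK.
- exact: realifyB.
- exact: realify_quadform.
- by rewrite addn_gt0 n_ge1.
Qed.
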